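(* Let $\phi$ be a cyclic formula modalised in the propositional variable $p$. Then $\mathsf{CHL}\vdash \boxdot^\bullet(p\leftrightarrow\phi)\to(p\leftrightarrow\digamma p.\phi)$.
   Context: Cyclic formulas. Labels: $\bot,\top$ and propositional variables (arity 0), $\neg,\Box$ (arity 1), $\wedge,\vee,\to$ (arity 2). A graph is $\langle V,r,S,\lambda\rangle$ with $V$ finite, root $r$, labelling $\lambda$, and $S:V\to V^{*}$ giving ordered successors (length = arity of the label); every vertex is reachable from $r$. A cycle is a set of pairwise distinct vertices $a_0,\dots,a_{k-1}$ with each $a_{j+1}$ a successor of $a_j$ and $a_0$ a successor of $a_{k-1}$. A (cyclic) formula is a graph in which every cycle contains a $\Box$-labelled vertex. Bisimulation $R$: $aRa'$ implies equal labels and $i$-th successors related; $\phi\simeq\psi$ iff a bisimulation relates the roots. Connectives build a new root over disjoint copies of the arguments. $\phi$ is modalised in $p$ if every path from the root to a $p$-labelled vertex passes through a $\Box$-labelled vertex. For such $\phi$, $\digamma p.\phi$ is the graph obtained by identifying the root with all $p$-labelled vertices (keeping the root's label). $\mathsf{CHL}$: the least set of cyclic formulas containing all substitution instances of propositional tautologies, all $\Box(\phi\to\psi)\to(\Box\phi\to\Box\psi)$, all $\phi\leftrightarrow\psi$ with $\phi\simeq\psi$, closed under modus ponens, necessitation, and Löb's rule (from $\vdash\Box\phi\to\phi$ infer $\vdash\phi$). $\Box^\bullet\phi:=\digamma q.\Box(\phi\wedge q)$ with $q$ not in $\phi$; $\boxdot^\bullet\phi:=\phi\wedge\Box^\bullet\phi$.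 *)

(* Defs.v *)
From HB Require Import structures.
From mathcomp Require Import all_boot.

Set Implicit Arguments.
Unset Strict Implicit.
Unset Printing Implicit Defensive.

Inductive label : Type :=
  | LBot | LTop | LVar of nat
  | LNeg | LBox
  | LAnd | LOr | LImp.

Definition label_comparable : comparable label.
Proof. move=> x y; rewrite /decidable; decide equality; exact: eq_comparable. Defined.
HB.instance Definition _ := hasDecEq.Build label (compareP label_comparable).

Definition arity (l : label) : nat :=
  match l with
  | LBot | LTop | LVar _ => 0
  | LNeg | LBox => 1
  | LAnd | LOr | LImp => 2
  end.

Record graph : Type := Graph {
  vertex :> finType;
  root : vertex;
  succ : vertex -> seq vertex;
  lab : vertex -> label;
  size_succ : forall v, size (succ v) = arity (lab v);
  reachable : forall v, connect (fun a b => b \in succ a) root v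
}.

Definition edge (G : graph) : rel G := fun a b => b \in succ a.

Definition is_box (G : graph) : pred G := fun v => lab v == LBox.

(* [ucycle] also accepts the empty sequence, which is not a cycle. *)
Definition boxed_cycles (G : graph) : Prop :=
  forall c : seq G, c != [::] -> ucycle (@edge G) c -> has (@is_box G) c.

Record formula : Type := Formula {
  formula_graph :> graph;
  formula_cycles : boxed_cycles formula_graph
}.

(* [nth a] and [nth a'] only carry default values: equal labels force
   [succ a] and [succ a'] to have the same length. *)
Definition bisimulation (G H : graph) (R : G -> H -> Prop) : Prop :=
  forall a a', R a a' ->
    lab a = lab a' /\
    forall i, i < size (succ a) -> R (nth a (succ a) i) (nth a' (succ a') i).

Definition bisimilar (G H : graph) : Prop :=
  exists R : G -> H -> Prop, bisimulation R /\ R (root G) (root H).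

Section Leaf.
Variables (l : label) (arity_l : arity l = 0).

Fact leaf_size (v : unit) : size ([::] : seq unit) = arity l.
Proof. by rewrite arity_l. Qed.

Fact leaf_reachable (v : unit) :
  connect (fun a b : unit => b \in ([::] : seq unit)) tt v.
Proof. by case: v; apply: connect0. Qed.

Definition leaf_graph : graph := Graph leaf_size leaf_reachable.

Fact leaf_cycles : boxed_cycles leaf_graph.
Proof. by case=> // -[] [|[] c] _ /andP []. Qed.

Definition leaf : formula := Formula leaf_cycles.
End Leaf.

Fact connect_homo (T U : finType) (e : rel T) (e' : rel U) (h : T -> U) x y :
  (forall a b, e a b -> e' (h a) (h b)) -> connect e x y ->
  connect e' (h x) (h y).
Proof.
move=> eh /connectP [s]; elim: s x => [|z s IH] x /=.
  by move=> _ ->; apply: connect0.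
move=> /andP [exz pzs] ly.
exact: connect_trans (connect1 (eh _ _ exz)) (IH z pzs ly).
Qed.

Fact cycle_pred_closed (T : eqType) (e : rel T) (P : pred T) (c : seq T) :
  (forall a b, e a b -> P a -> P b) -> cycle e c -> has P c -> all P c.
Proof.
move=> clP cc /hasP [x xc Px]; case/rot_to: xc => i s rs.
rewrite -(eq_all_r (mem_rot i c)) rs /= Px /=; move: cc; rewrite -(rot_cycle i) rs /=.
rewrite rcons_path => /andP [+ _]; elim: s x Px {rs} => //= y s IH x Px.
by move=> /andP [/clP /(_ Px) Py /(IH _ Py) ->]; rewrite Py.
Qed.

Fact copy_cycles (G H : graph) (h : G -> H) :
  injective h ->
  (forall v, succ (h v) = map h (succ v)) ->
  (forall v, lab (h v) = lab v) ->
  boxed_cycles G ->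
  forall c : seq H, ucycle (@edge H) c -> c != [::] ->
    all (fun w => w \in codom h) c -> has (@is_box H) c.
Proof.
move=> hI hS hL bG c uc c0 ac.
have [s Es] : exists s, c = map h s.
  elim: c ac {uc c0} => [|w c IH] /=; first by exists [::].
  by move=> /andP [/codomP [v ->] /IH [s ->]]; exists (v :: s).
move: uc c0; rewrite {}Es => /andP [cc uq] s0.
have heE a b : edge (h a) (h b) = edge a b by rewrite /edge hS mem_map.
have pm x t : path (@edge H) (h x) (map h t) = path (@edge G) x t.
  by elim: t x => //= y t IH x; rewrite heE IH.
have cs : cycle (@edge G) s.
  by case: s cc {s0 uq ac} => //= x s; rewrite -map_rcons pm.
have s0' : s != [::] by case: s s0 {cc uq cs ac}.
have us : ucycle (@edge G) s by rewrite /ucycle cs -(map_inj_uniq hI).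
have := bG s s0' us; rewrite has_map; apply: sub_has => v.
by rewrite /is_box /= hL.
Qed.

Section Unary.
Variables (l : label) (arity_l : arity l = 1) (phi : formula).

Definition unary_succ (v : option phi) : seq (option phi) :=
  match v with
  | None => [:: Some (root phi)]
  | Some a => map Some (succ a)
  end.

Definition unary_lab (v : option phi) : label :=
  match v with None => l | Some a => lab a end.

Fact unary_size v : size (unary_succ v) = arity (unary_lab v).
Proof. by case: v => [a|] /=; rewrite ?size_map ?size_succ ?arity_l. Qed.

Fact unary_reachable v : connect (fun a b => b \in unary_succ a) None v.
Proof.
case: v => [a|]; last exact: connect0.
apply: (connect_trans (y := Some (root phi))).
  by apply: connect1; rewrite inE.
apply: connect_homo (reachable a) => x y xy /=; exact: map_f.
Qed.

Definition unary_graph : graph := Graph unary_size unary_reachable.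

Fact unary_cycles : boxed_cycles unary_graph.
Proof.
move=> [|x c] // c0 uc; have /andP [cc _] := uc.
apply: (@copy_cycles phi unary_graph Some) (x :: c) uc c0 _ => //.
- by move=> a b [].
- exact: formula_cycles.
have clP a b : @edge unary_graph a b -> (b : option phi) \in codom (@Some phi).
  case: a => [a|]; rewrite /edge /= ?inE.
    by case/mapP=> w _ ->; apply: codom_f.
  by move/eqP->; apply: codom_f.
apply: (@cycle_pred_closed _ (@edge unary_graph)) => // [a b /clP //|].
have h := next_cycle cc (mem_head x c).
by apply/hasP; exists (next (x :: c) x); [rewrite mem_next mem_head | exact: clP h].
Qed.

Definition unary : formula := Formula unary_cycles.
End Unary.

Section Binary.
Variables (l : label) (arity_l : arity l = 2) (phi psi : formula).

Definition binary_vertex : finType := option (phi + psi)%type.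

Definition binary_succ (v : binary_vertex) : seq binary_vertex :=
  match v with
  | None => [:: Some (inl (root phi)); Some (inr (root psi))]
  | Some (inl a) => [seq Some (inl b) | b <- succ a]
  | Some (inr a) => [seq Some (inr b) | b <- succ a]
  end.

Definition binary_lab (v : binary_vertex) : label :=
  match v with
  | None => l
  | Some (inl a) => lab a
  | Some (inr a) => lab a
  end.

Fact binary_size v : size (binary_succ v) = arity (binary_lab v).
Proof. by case: v => [[a|a]|] /=; rewrite ?size_map ?size_succ ?arity_l. Qed.

Fact binary_reachable v : connect (fun a b => b \in binary_succ a) None v.
Proof.
case: v => [[a|a]|]; last exact: connect0.
  apply: (connect_trans (y := Some (inl (root phi)))).
    by apply: connect1; rewrite !inE eqxx.
  apply: (connect_homo (h := fun b => Some (inl b))) (reachable a) => x y xy /=.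
  by apply/mapP; exists y.
apply: (connect_trans (y := Some (inr (root psi)))).
  by apply: connect1; rewrite !inE eqxx orbT.
apply: (connect_homo (h := fun b => Some (inr b))) (reachable a) => x y xy /=.
by apply/mapP; exists y.
Qed.

Definition binary_graph : graph := Graph binary_size binary_reachable.

Fact binary_cycles : boxed_cycles binary_graph.
Proof.
pose hl (b : phi) : binary_graph := Some (inl b).
pose hr (b : psi) : binary_graph := Some (inr b).
have cl a b : @edge binary_graph a b -> a \in codom hl -> b \in codom hl.
  move=> ab /codomP [x ax]; move: ab; rewrite ax /edge => /mapP [y _ ->].
  exact: (codom_f hl).
have cr a b : @edge binary_graph a b -> a \in codom hr -> b \in codom hr.
  move=> ab /codomP [x ax]; move: ab; rewrite ax /edge => /mapP [y _ ->].
  exact: (codom_f hr).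
move=> [|x c] // c0 uc; have /andP [cc _] := uc.
have := next_cycle cc (mem_head x c); set y := next _ _ => xy.
have yc : y \in x :: c by rewrite mem_next mem_head.
have : (y \in codom hl) || (y \in codom hr).
  case: y {yc} xy => [[a|a]|].
  - by move=> _; rewrite (codom_f hl).
  - by move=> _; rewrite (codom_f hr) orbT.
  - case: x {c0 uc cc} => [[a|a]|]; rewrite /edge /=.
    + by case/mapP.
    + by case/mapP.
    + by rewrite !inE.
case/orP=> hy.
  apply: (@copy_cycles phi binary_graph hl) (x :: c) uc c0 _ => //.
  - by move=> a b [].
  - exact: formula_cycles.
  by apply: cycle_pred_closed cl cc _; apply/hasP; exists y.
apply: (@copy_cycles psi binary_graph hr) (x :: c) uc c0 _ => //.
- by move=> a b [].
- exact: formula_cycles.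
by apply: cycle_pred_closed cr cc _; apply/hasP; exists y.
Qed.

Definition binary : formula := Formula binary_cycles.
End Binary.

Definition Bot : formula := @leaf LBot erefl.
Definition Top : formula := @leaf LTop erefl.
Definition Var (p : nat) : formula := @leaf (LVar p) erefl.
Definition Neg (phi : formula) : formula := @unary LNeg erefl phi.
Definition Box (phi : formula) : formula := @unary LBox erefl phi.
Definition And (phi psi : formula) : formula := @binary LAnd erefl phi psi.
Definition Or (phi psi : formula) : formula := @binary LOr erefl phi psi.
Definition Imp (phi psi : formula) : formula := @binary LImp erefl phi psi.
Definition Iff (phi psi : formula) : formula := And (Imp phi psi) (Imp psi phi).

Definition occurs (p : nat) (G : graph) : bool := [exists v : G, lab v == LVar p].

Definition modalised (p : nat) (G : graph) : Prop :=
  forall s : seq G, path (@edge G) (root G) s ->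
    lab (last (root G) s) = LVar p -> has (@is_box G) (root G :: s).

Section Digamma.
Variables (p : nat) (G : graph).

(* The class of the root is represented by the root, every other class is a
   singleton. *)
Definition digamma_vertex : finType :=
  {v : G | (v == root G) || (lab v != LVar p)}.

Definition digamma_root : digamma_vertex :=
  Sub (root G) (introT orP (or_introl (eqxx (root G)))).

Definition digamma_class (v : G) : digamma_vertex := insubd digamma_root v.

Definition digamma_succ (v : digamma_vertex) : seq digamma_vertex :=
  map digamma_class (succ (val v)).

Definition digamma_lab (v : digamma_vertex) : label := lab (val v).

Fact digamma_size v : size (digamma_succ v) = arity (digamma_lab v).
Proof. by rewrite size_map size_succ. Qed.

Fact digamma_reachable v : connect (fun a b => b \in digamma_succ a) digamma_root v.
Proof.
have -> : v = digamma_class (val v) by rewrite /digamma_class valKd.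
have -> : digamma_root = digamma_class (root G).
  by apply: val_inj; rewrite val_insubd eqxx.
apply: connect_homo (reachable (val v)) => a b ab; apply: map_f.
rewrite /digamma_class val_insubd.
case: ifP => // /norP [_ /negPn /eqP la].
by move: ab; rewrite (size0nil (_ : size (succ a) = 0)) // size_succ la.
Qed.

Definition digamma_graph : graph := Graph digamma_size digamma_reachable.
End Digamma.

Section DigammaFormula.
Variables (p : nat) (phi : formula) (phi_mod : modalised p phi).

Notation D := (digamma_graph p phi).

Fact digamma_edge (a b : D) :
  edge a b -> b != root D -> edge (val a) (val b).
Proof.
rewrite /edge => /mapP [w wa ->]; rewrite /digamma_class.
case: (insubP (digamma_vertex p phi) w) => [u Pu vu|nP].
  by rewrite val_insubd Pu.
by rewrite /insubd insubN //= eqxx.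
Qed.

Fact digamma_path (a : D) (s : seq D) :
  path (@edge D) a s -> root D \notin s -> path (@edge phi) (val a) (map val s).
Proof.
elim: s a => //= b s IH a /andP [ab pbs]; rewrite inE => /norP [br rs].
by rewrite (IH _ pbs rs) digamma_edge // eq_sym.
Qed.

Fact digamma_cycles : boxed_cycles D.
Proof.
move=> c c0 uc; have /andP [cc uqc] := uc.
have boxE (s : seq D) : has (@is_box phi) (map val s) = has (@is_box D) s.
  by rewrite has_map.
case: (boolP (root D \in c)) => [/rot_to [i s rs]|rc].
  move: cc uqc; rewrite -(rot_cycle i) -(rot_uniq i) -(eq_has_r (mem_rot i c)) rs.
  rewrite /= rcons_path => /andP [ps er] /andP [rs' us].
  have pphi := digamma_path ps rs'.
  have [w we rw] := mapP er.
  have lE : val (last (root D) s) = last (root phi) (map val s).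
    by rewrite (last_map val s (root D)).
  have [Pw|nPw] := boolP ((w == root phi) || (lab w != LVar p)).
    have wr : w = root phi.
      by have := congr1 val rw; rewrite /digamma_class val_insubd Pw.
    change (is_true (has (@is_box D) (root D :: s))).
    rewrite -(boxE (root D :: s)).
    apply: (formula_cycles (f := phi)) => //.
    rewrite /ucycle (map_inj_uniq val_inj) /= rs' us !andbT.
    rewrite rcons_path pphi /=.
    by move: we; rewrite /edge -lE wr.
  have lw : lab w = LVar p by move/norP: nPw => [_ /negPn /eqP].
  have := phi_mod (s := rcons (map val s) w); rewrite last_rcons rcons_path.
  rewrite pphi -lE /edge => /(_ we lw).
  rewrite -rcons_cons has_rcons {1}/is_box lw /=.
  by rewrite -(boxE s).
case: c c0 uc cc uqc rc => // x s _ uc cc uqc rc.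
rewrite -boxE; apply: (formula_cycles (f := phi)) => //.
rewrite /ucycle (map_inj_uniq val_inj) uqc andbT /= -map_rcons.
apply: digamma_path => //.
by move: rc; rewrite mem_rcons.
Qed.

Definition digamma : formula := Formula digamma_cycles.
End DigammaFormula.

Fact modalised_Box (p : nat) (phi : formula) : modalised p (Box phi).
Proof. by []. Qed.

(* The bound variable [q] is meant to be fresh for [phi]. *)
Definition BoxBullet (q : nat) (phi : formula) : formula :=
  digamma (@modalised_Box q (And phi (Var q))).

Definition BoxdotBullet (q : nat) (phi : formula) : formula :=
  And phi (BoxBullet q phi).

Inductive prop_form : Type :=
  | PVar of nat
  | PBot
  | PTop
  | PNeg of prop_form
  | PAnd of prop_form & prop_form
  | POr of prop_form & prop_form
  | PImp of prop_form & prop_form.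

Fixpoint prop_eval (e : nat -> bool) (A : prop_form) : bool :=
  match A with
  | PVar n => e n
  | PBot => false
  | PTop => true
  | PNeg B => ~~ prop_eval e B
  | PAnd B C => prop_eval e B && prop_eval e C
  | POr B C => prop_eval e B || prop_eval e C
  | PImp B C => prop_eval e B ==> prop_eval e C
  end.

Definition tautology (A : prop_form) : Prop := forall e, prop_eval e A.

Fixpoint prop_subst (sigma : nat -> formula) (A : prop_form) : formula :=
  match A with
  | PVar n => sigma n
  | PBot => Bot
  | PTop => Top
  | PNeg B => Neg (prop_subst sigma B)
  | PAnd B C => And (prop_subst sigma B) (prop_subst sigma C)
  | POr B C => Or (prop_subst sigma B) (prop_subst sigma C)
  | PImp B C => Imp (prop_subst sigma B) (prop_subst sigma C)
  end.

Inductive CHL : formula -> Prop :=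
  | CHL_taut (A : prop_form) (sigma : nat -> formula) :
      tautology A -> CHL (prop_subst sigma A)
  | CHL_K (phi psi : formula) :
      CHL (Imp (Box (Imp phi psi)) (Imp (Box phi) (Box psi)))
  | CHL_bisim (phi psi : formula) :
      bisimilar phi psi -> CHL (Iff phi psi)
  | CHL_mp (phi psi : formula) :
      CHL (Imp phi psi) -> CHL phi -> CHL psi
  | CHL_nec (phi : formula) :
      CHL phi -> CHL (Box phi)
  | CHL_lob (phi : formula) :
      CHL (Imp (Box phi) phi) -> CHL phi.

(* Main.v *)
(** Write [F_v] for the subformula of [F] at a vertex [v], and [B] for
    [⊡•(p <-> phi)].  By Löb's rule applied to the conjunction over all vertices
    [v] of [phi] of the formulas [B -> (phi_v <-> (ϝp.phi)_[v])], these
    equivalences may be assumed under a box.  Since [B] implies [Box B], this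
    settles the [Box]-labelled vertices.  The others follow by induction along
    the edges of [ϝp.phi] that leave unboxed vertices, a well-founded relation
    because every cycle is boxed; at a [p]-labelled vertex, whose class is the
    root, one uses [p <-> phi]. *)
Require Import Defs.
From mathcomp Require Import all_boot.

Set Implicit Arguments.
Unset Strict Implicit.
Unset Printing Implicit Defensive.

(* [all_boot] shadows [Defs.root] by [fingraph.root]. *)
Local Notation root := Defs.root.

(** * Bisimilarity of vertices *)

(** Relating arbitrary vertices lets formulas be compared through their parts; at the roots this is
    convertible to [bisimilar]. *)
Definition bsim (G H : graph) (a : G) (b : H) : Prop :=
  exists R : G -> H -> Prop, bisimulation R /\ R a b.

Lemma bisim_bsim (G H : graph) : bisimulation (@bsim G H).
Proof.
move=> a b [R [bR Rab]]; have [ll nn] := bR _ _ Rab; split=> // i /nn Ri.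
by exists R.
Qed.

Lemma bsim_step (G H : graph) (a : G) (b : H) :
  lab a = lab b ->
  (forall i, i < size (succ a) -> bsim (nth a (succ a) i) (nth b (succ b) i)) ->
  bsim a b.
Proof.
move=> ll nn; exists (fun x y => (x = a /\ y = b) \/ bsim x y); split; last by left.
move=> x y [[-> ->]|xy]; first by split=> // i /nn; right.
have [l' n'] := bisim_bsim xy; split=> // i /n'; by right.
Qed.

Lemma size_succ_eq (G H : graph) (a : G) (b : H) :
  lab a = lab b -> size (succ a) = size (succ b).
Proof. by rewrite !size_succ => ->. Qed.

(** The graph of [h] on [P] is a bisimulation. The restriction to a successor-closed [P] serves
    [sub_class], which is faithful only on vertices reachable from [v]. *)
Lemma bsim_fun (G H : graph) (P : pred G) (h : G -> H) (a : G) :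
  (forall x, P x -> lab (h x) = lab x /\ succ (h x) = map h (succ x)) ->
  (forall x y, P x -> y \in succ x -> P y) -> P a -> bsim a (h a).
Proof.
move=> hP cP Pa; exists (fun x y => P x /\ y = h x); split=> // x _ [Px ->].
have [lx sx] := hP _ Px; split=> // i ilt; split.
  exact: cP Px (mem_nth _ ilt).
by rewrite sx (nth_map x).
Qed.

Lemma bsim_sym (G H : graph) (a : G) (b : H) : bsim a b -> bsim b a.
Proof.
move=> [R [bR Rab]]; exists (fun x y => R y x); split=> // x y Ryx.
have [ll nn] := bR _ _ Ryx; split=> // i.
by rewrite -(size_succ_eq ll) => /nn.
Qed.

Lemma bsim_trans (G H K : graph) (a : G) (b : H) (c : K) :
  bsim a b -> bsim b c -> bsim a c.
Proof.
move=> ab bc; exists (fun x z => exists y : H, bsim x y /\ bsim y z).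
split; last by exists b.
move=> x z [y [/bisim_bsim [l1 n1] /bisim_bsim [l2 n2]]]; split.
  by rewrite l1.
move=> i ix; exists (nth y (succ y) i); split; first exact: n1.
by apply: n2; rewrite -(size_succ_eq l1).
Qed.

Lemma bsim_unary (G : graph) (a b : G) l (al : arity l = 1) (psi : formula) :
  lab a = l -> succ a = [:: b] -> bsim b (root psi) ->
  bsim a (root (unary al psi)).
Proof.
move=> la sa bb; apply: bsim_step => //; rewrite sa => -[|//] _ /=.
by apply: (bsim_trans bb); apply: (@bsim_fun psi (unary al psi) predT Some).
Qed.

Lemma bsim_binary (G : graph) (a b c : G) l (al : arity l = 2)
    (psi chi : formula) :
  lab a = l -> succ a = [:: b; c] -> bsim b (root psi) -> bsim c (root chi) ->
  bsim a (root (binary al psi chi)).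
Proof.
move=> la sa bb cc; apply: bsim_step => //; rewrite sa => -[|[|//]] _ /=.
  apply: (bsim_trans bb).
  by apply: (@bsim_fun psi (binary al psi chi) predT (fun x => Some (inl x))).
apply: (bsim_trans cc).
by apply: (@bsim_fun chi (binary al psi chi) predT (fun x => Some (inr x))).
Qed.

(** * Subformulas *)

Section Subformula.
Variables (F : formula) (v : F).

Definition sub_vertex : finType := {w : F | connect (@edge F) v w}.

Definition sub_root : sub_vertex := Sub v (connect0 _ _).

(** The default [sub_root] only makes the map total: successors of vertices reachable from [v] are
    again reachable. *)
Definition sub_class (w : F) : sub_vertex := insubd sub_root w.

Definition sub_succ (w : sub_vertex) : seq sub_vertex :=
  map sub_class (succ (val w)).

Definition sub_lab (w : sub_vertex) : label := lab (val w).

Lemma sub_size w : size (sub_succ w) = arity (sub_lab w).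
Proof. by rewrite size_map size_succ. Qed.

Lemma val_sub_class w : connect (@edge F) v w -> val (sub_class w) = w.
Proof. by move=> vw; rewrite val_insubd vw. Qed.

Lemma sub_reachable w : connect (fun a b => b \in sub_succ a) sub_root w.
Proof.
have -> : sub_root = sub_class v by apply: val_inj; rewrite val_sub_class.
have -> : w = sub_class (val w) by rewrite /sub_class valKd.
have /connectP [s ps ->] := valP w.
(* Edges are preserved by [sub_class] only out of vertices reachable from [v], so the path is
   followed with that invariant. *)
suff tail x : path (@edge F) x s -> connect (@edge F) v x ->
    connect (fun a b => b \in sub_succ a) (sub_class x) (sub_class (last x s)).
  exact: tail ps (connect0 _ _).
elim: s x {ps} => [|y s IH] x /= + vx.
  by move=> _; apply: connect0.
move=> /andP [xy ys]; have vy := connect_trans vx (connect1 xy).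
apply: connect_trans (IH _ ys vy); apply: connect1.
by rewrite /sub_succ val_sub_class // map_f.
Qed.

Definition sub_graph : graph := Graph sub_size sub_reachable.

Lemma sub_edge (a b : sub_graph) : edge a b -> edge (val a) (val b).
Proof.
rewrite /edge => /mapP [w wa ->]; rewrite val_sub_class //.
exact: connect_trans (valP a) (connect1 wa).
Qed.

Lemma sub_cycles : boxed_cycles sub_graph.
Proof.
move=> c c0 /andP [cc uc].
have -> : has (@is_box sub_graph) c = has (@is_box F) (map val c).
  by rewrite has_map.
apply: (formula_cycles (f := F)); first by case: c c0 {cc uc}.
rewrite /ucycle (map_inj_uniq val_inj) uc andbT cycle_map.
exact: sub_cycle sub_edge _ _.
Qed.

Definition sub_formula : formula := Formula sub_cycles.

Lemma bsim_sub : bsim v (root sub_formula).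
Proof.
have -> : root sub_formula = sub_class v by apply: val_inj; rewrite val_sub_class.
apply: (@bsim_fun F sub_formula (connect (@edge F) v)) => //.
  by move=> x vx; rewrite /= /sub_lab /sub_succ val_sub_class.
by move=> x y vx xy; apply: connect_trans vx (connect1 _).
Qed.
End Subformula.

(** The calculus sees connectives, not vertices; this turns the label of a vertex into a connective
    up to provable equivalence. *)
Lemma bisimilar_sub_unary (F : formula) (v w : F) l (al : arity l = 1) :
  lab v = l -> succ v = [:: w] ->
  bisimilar (sub_formula v) (unary al (sub_formula w)).
Proof.
move=> lv sv; apply: (bsim_trans (bsim_sym (bsim_sub v))).
exact: bsim_unary lv sv (bsim_sub w).
Qed.

Lemma bisimilar_sub_binary (F : formula) (v w x : F) l (al : arity l = 2) :
  lab v = l -> succ v = [:: w; x] ->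
  bisimilar (sub_formula v) (binary al (sub_formula w) (sub_formula x)).
Proof.
move=> lv sv; apply: (bsim_trans (bsim_sym (bsim_sub v))).
exact: bsim_binary lv sv (bsim_sub w) (bsim_sub x).
Qed.

(** Since [q] does not occur in [psi], the identification redirects only the leaf [Var q] to the
    root, and the copy of [psi] survives unchanged. *)
Lemma BoxBullet_unfold (q : nat) (psi : formula) :
  ~~ occurs q psi -> bisimilar (BoxBullet q psi) (Box (And psi (BoxBullet q psi))).
Proof.
move=> qf; set X := BoxBullet q psi; set A := Box (And psi (Var q)).
have nq (x : psi) : lab x != LVar q.
  by apply/negP => lx; move/negP: qf; apply; apply/existsP; exists x.
pose cl : A -> X := @digamma_class q A.
have clE x : lab x != LVar q -> val (cl x) = x.
  by move=> lx; rewrite val_insubd lx orbT.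
have clq x : lab x = LVar q -> cl x = root X.
  by move=> lx; apply: val_inj; rewrite val_insubd lx eqxx orbF; case: eqP.
(* In [A], [None] is the box, [Some None] the conjunction, [Some (Some (inl x))] a vertex of [psi],
   and [Some (Some (inr tt))] the leaf [Var q]. *)
pose a0 : A := Some None; pose h (x : psi) : A := Some (Some (inl x)).
have sr : succ (root X) = [:: cl a0] by [].
have sa : succ (cl a0) = [:: cl (h (root psi)); root X].
  have -> : succ (cl a0) = map cl (succ (val (cl a0))) by [].
  by rewrite clE //= (clq (Some (Some (inr tt)))).
have la : lab (cl a0) = LAnd.
  have -> : lab (cl a0) = lab (val (cl a0)) by [].
  by rewrite clE.
apply: bsim_unary sr _ => //; apply: bsim_binary la sa _ _; last first.
  by apply: (@bsim_fun X X predT id) => // x _; rewrite map_id.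
apply: bsim_sym; apply: (@bsim_fun psi X predT (cl \o h)) => // x _.
have -> : lab ((cl \o h) x) = lab (val (cl (h x))) by [].
have -> : succ ((cl \o h) x) = map cl (succ (val (cl (h x)))) by [].
by rewrite clE ?nq //= -!map_comp.
Qed.

(** * Derivations from a hypothesis *)

(** Each premise moves into the conclusion as an antecedent, so one tautology followed by repeated
    modus ponens suffices. *)
Lemma CHL_consequence (sigma : nat -> formula) (Ps : seq prop_form)
    (A : prop_form) :
  (forall e, all (prop_eval e) Ps ==> prop_eval e A) ->
  foldr (fun P => and (CHL (prop_subst sigma P))) True Ps ->
  CHL (prop_subst sigma A).
Proof.
elim: Ps A => [|P Ps IH] A /= tA; first by move=> _; apply: CHL_taut.
move=> [cP cPs]; apply: CHL_mp cP; apply: (IH (PImp P A)) cPs => e /=.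
by have := tA e; do 2 case: (prop_eval _ _); case: all.
Qed.

Definition entails (G f : formula) : Prop := CHL (Imp G f).

(** Only variables 0 to 4 occur in the schemas below, so 32 valuations decide each of them. *)
Ltac prop_solve :=
  let e := fresh in
  move=> e /=; case: (e 0); case: (e 1); case: (e 2); case: (e 3); case: (e 4).

Local Notation "''P_' n" := (PVar n) (at level 8, n at level 2).
Local Notation PIff A B := (PAnd (PImp A B) (PImp B A)).

Lemma entails_const G f : CHL f -> entails G f.
Proof.
move=> cf.
by apply: (@CHL_consequence (nth Bot [:: G; f]) [:: 'P_1] (PImp 'P_0 'P_1));
  [prop_solve | split].
Qed.

Lemma entails_trans F G H : entails F G -> entails G H -> entails F H.
Proof.
move=> FG GH.
by apply: (@CHL_consequence (nth Bot [:: F; G; H])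
  [:: PImp 'P_0 'P_1; PImp 'P_1 'P_2] (PImp 'P_0 'P_2)); [prop_solve | split].
Qed.

Lemma entails_mp G f g : entails G (Imp f g) -> entails G f -> entails G g.
Proof.
move=> Gfg Gf.
by apply: (@CHL_consequence (nth Bot [:: G; f; g])
  [:: PImp 'P_0 (PImp 'P_1 'P_2); PImp 'P_0 'P_1] (PImp 'P_0 'P_2));
  [prop_solve | split].
Qed.

Lemma entails_imp G f g : entails (And G f) g -> entails G (Imp f g).
Proof.
move=> Gfg.
by apply: (@CHL_consequence (nth Bot [:: G; f; g])
  [:: PImp (PAnd 'P_0 'P_1) 'P_2] (PImp 'P_0 (PImp 'P_1 'P_2)));
  [prop_solve | split].
Qed.

Lemma entails_and G f g : entails G f -> entails G g -> entails G (And f g).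
Proof.
move=> Gf Gg.
by apply: (@CHL_consequence (nth Bot [:: G; f; g])
  [:: PImp 'P_0 'P_1; PImp 'P_0 'P_2] (PImp 'P_0 (PAnd 'P_1 'P_2)));
  [prop_solve | split].
Qed.

Lemma entails_andl f g : entails (And f g) f.
Proof.
by apply: (@CHL_taut (PImp (PAnd 'P_0 'P_1) 'P_0) (nth Bot [:: f; g])); prop_solve.
Qed.

Lemma entails_andr f g : entails (And f g) g.
Proof.
by apply: (@CHL_taut (PImp (PAnd 'P_0 'P_1) 'P_1) (nth Bot [:: f; g])); prop_solve.
Qed.

Lemma entails_iff_sym G f g : entails G (Iff f g) -> entails G (Iff g f).
Proof.
move=> Gfg.
by apply: (@CHL_consequence (nth Bot [:: G; f; g])
  [:: PImp 'P_0 (PIff 'P_1 'P_2)] (PImp 'P_0 (PIff 'P_2 'P_1)));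
  [prop_solve | split].
Qed.

Lemma entails_iff_trans G f g h :
  entails G (Iff f g) -> entails G (Iff g h) -> entails G (Iff f h).
Proof.
move=> Gfg Ggh.
by apply: (@CHL_consequence (nth Bot [:: G; f; g; h])
  [:: PImp 'P_0 (PIff 'P_1 'P_2); PImp 'P_0 (PIff 'P_2 'P_3)]
  (PImp 'P_0 (PIff 'P_1 'P_3))); [prop_solve | split].
Qed.

Lemma entails_iff_bisimilar (G f f' g g' : formula) :
  bisimilar f f' -> bisimilar g g' ->
  entails G (Iff f' g') -> entails G (Iff f g).
Proof.
move=> ff gg fg; apply: entails_iff_trans (entails_const G (CHL_bisim ff)) _.
apply: entails_iff_trans fg _.
exact: entails_iff_sym (entails_const G (CHL_bisim gg)).
Qed.

Lemma entails_iff_Neg G f g :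
  entails G (Iff f g) -> entails G (Iff (Neg f) (Neg g)).
Proof.
move=> Gfg.
by apply: (@CHL_consequence (nth Bot [:: G; f; g])
  [:: PImp 'P_0 (PIff 'P_1 'P_2)] (PImp 'P_0 (PIff (PNeg 'P_1) (PNeg 'P_2))));
  [prop_solve | split].
Qed.

Section BinaryCongruence.
Variables (G f g f' g' : formula).
Hypotheses (ff : entails G (Iff f f')) (gg : entails G (Iff g g')).

Let congr (op : prop_form -> prop_form -> prop_form) :
  (forall e, prop_eval e (PIff 'P_1 'P_3) && prop_eval e (PIff 'P_2 'P_4) ==>
     prop_eval e (PIff (op 'P_1 'P_2) (op 'P_3 'P_4))) ->
  CHL (prop_subst (nth Bot [:: G; f; g; f'; g'])
    (PImp 'P_0 (PIff (op 'P_1 'P_2) (op 'P_3 'P_4)))).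
Proof.
move=> tA; apply: (@CHL_consequence _
  [:: PImp 'P_0 (PIff 'P_1 'P_3); PImp 'P_0 (PIff 'P_2 'P_4)]) => // e.
by move: (tA e) => /=; case: (e 0); rewrite /= ?andbT.
Qed.

Lemma entails_iff_And : entails G (Iff (And f g) (And f' g')).
Proof. by apply: (congr (op := PAnd)); prop_solve. Qed.

Lemma entails_iff_Or : entails G (Iff (Or f g) (Or f' g')).
Proof. by apply: (congr (op := POr)); prop_solve. Qed.

Lemma entails_iff_Imp : entails G (Iff (Imp f g) (Imp f' g')).
Proof. by apply: (congr (op := PImp)); prop_solve. Qed.
End BinaryCongruence.

Lemma entails_Box f g : entails f g -> entails (Box f) (Box g).
Proof. by move=> fg; apply: CHL_mp (CHL_K f g) (CHL_nec fg). Qed.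

(** The K axiom distributes the box over each direction. The equivalence is required under the box
    because [G] need not imply its own necessitation. *)
Lemma entails_iff_Box G f g :
  entails G (Box (Iff f g)) -> entails G (Iff (Box f) (Box g)).
Proof.
move=> Gfg; apply: entails_and.
  apply: entails_trans Gfg _; apply: entails_trans (CHL_K f g).
  exact/entails_Box/entails_andl.
apply: entails_trans Gfg _; apply: entails_trans (CHL_K g f).
exact/entails_Box/entails_andr.
Qed.

Definition Conj (T : Type) (f : T -> formula) (s : seq T) : formula :=
  foldr (fun x => And (f x)) Top s.

Lemma conj_elim (T : eqType) (f : T -> formula) s x :
  x \in s -> entails (Conj f s) (f x).
Proof.
elim: s => //= y s IH; rewrite inE => /predU1P [->|/IH xs].
  exact: entails_andl.
exact: entails_trans (entails_andr _ _) xs.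
Qed.

Lemma conj_intro (T : Type) (G : formula) (f : T -> formula) s :
  (forall x, entails G (f x)) -> entails G (Conj f s).
Proof.
move=> Gf; elim: s => [|y s IH] /=; last exact: entails_and.
by apply: entails_const; apply: (@CHL_taut PTop (fun=> Bot)).
Qed.

(** * The vertexwise equivalence *)

(** The set of vertices reachable along edges that leave unboxed vertices shrinks strictly at each
    such edge. *)
Lemma unboxed_succ_ind (F : formula) (P : F -> Prop) :
  (forall v, (lab v != LBox -> forall w, w \in succ v -> P w) -> P v) ->
  forall v, P v.
Proof.
move=> IH.
pose e : rel F := fun a b => (lab a != LBox) && edge a b.
have acyclic a b : e a b -> connect e b a = false.
  move=> ab; apply/negP => /connectP [s ps la]; subst a.
  (* The path is shortened because [ucycle] asks for distinct vertices. *)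
  move: ab; case/shortenP: ps => s' ps' us' _ ab.
  have ce : cycle e (b :: s') by rewrite /= rcons_path ps'.
  have ue : ucycle (@edge F) (b :: s').
    by rewrite /ucycle us' andbT; apply: sub_cycle ce => x y /andP [].
  (* The boxed vertex on this cycle would have an [e]-edge to the next one, which [e] forbids. *)
  have /hasP [x xs bx] := @formula_cycles F (b :: s') isT ue.
  by have /andP [/negP] := next_cycle ce xs.
move=> v; have [n] := ubnP #|connect e v|; elim: n v => // n IHn v.
rewrite ltnS => nv; apply: IH => nb w vw; apply: IHn; apply: leq_trans nv.
have evw : e v w by rewrite /e nb.
apply: proper_card; apply/properP; split.
  by apply/subsetP => x; apply: connect_trans (connect1 evw).
by exists v; rewrite !inE ?connect0 // acyclic.
Qed.

(** Boolean connectives respect equivalence under a hypothesis, but a box does so only when the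
    equivalence itself is boxed; hence the conditional. *)
Lemma entails_iff_sub (F H : formula) (v : F) (u : H) (G : formula) :
  lab u = lab v ->
  (forall i, i < size (succ v) ->
    entails G ((if lab v == LBox then Box else id)
      (Iff (sub_formula (nth v (succ v) i)) (sub_formula (nth u (succ u) i))))) ->
  entails G (Iff (sub_formula v) (sub_formula u)).
Proof.
move=> lu; case lv: (lab v) lu => [||n|||||] lu.
(* At arity 0 there are no successors to compare, so equal labels already give bisimilarity. *)
1-3: move=> _; apply/entails_const/CHL_bisim.
1-3: apply: (bsim_trans (bsim_sym (bsim_sub v))).
1-3: apply: (bsim_trans _ (bsim_sub u)); apply: bsim_step; first by rewrite lv lu.
1-3: by rewrite size_succ lv.
all: have := size_succ u; have := size_succ v; rewrite lv lu /=.
all: case sv: (succ v) => [|w [|x [|//]]] //; case su: (succ u) => [|w' [|x' [|//]]] //.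
all: move=> _ _ eqs; have := eqs 0 isT; try have := eqs 1 isT.
all: rewrite /=.
- move=> e0; apply: entails_iff_bisimilar (entails_iff_Neg e0);
    exact: bisimilar_sub_unary.
- move=> e0; apply: entails_iff_bisimilar (entails_iff_Box e0);
    exact: bisimilar_sub_unary.
- move=> e1 e0; apply: entails_iff_bisimilar (entails_iff_And e0 e1);
    exact: bisimilar_sub_binary.
- move=> e1 e0; apply: entails_iff_bisimilar (entails_iff_Or e0 e1);
    exact: bisimilar_sub_binary.
- move=> e1 e0; apply: entails_iff_bisimilar (entails_iff_Imp e0 e1);
    exact: bisimilar_sub_binary.
Qed.

Lemma val_digamma_class (p : nat) (F : graph) (v : F) :
  lab v != LVar p -> val (digamma_class p v) = v.
Proof. by move=> lv; rewrite val_insubd lv orbT. Qed.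

(** The empty path already reaches the root, whose label cannot be both [LVar p] and [LBox]. *)
Lemma modalised_root (p : nat) (F : graph) :
  modalised p F -> lab (root F) != LVar p.
Proof.
move=> mF; apply/eqP => lr.
by have := mF [::] isT lr; rewrite /= /is_box lr.
Qed.

Lemma digamma_class_var (p : nat) (F : graph) (v : F) :
  lab v = LVar p -> digamma_class p v = root (digamma_graph p F).
Proof.
move=> lv; apply: val_inj; rewrite val_insubd lv eqxx orbF.
by case: eqP.
Qed.

Lemma digamma_class_root (p : nat) (F : graph) :
  digamma_class p (root F) = root (digamma_graph p F).
Proof. by apply: val_inj; rewrite val_insubd eqxx. Qed.

Section VertexwiseEquivalence.
Variables (p : nat) (phi : formula) (phi_mod : modalised p phi) (G : formula).

Notation X := (digamma phi_mod).
Notation cl := (@digamma_class p phi : phi -> X).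

(** The induction runs on the class in [X], not on the vertex of [phi]: passing from a [p]-labelled
    vertex to the root keeps the class. Vertices not labelled [p] are therefore settled first,
    within the same induction step. *)
Lemma entails_iff_sub_digamma :
  entails G (Iff (Var p) (sub_formula (root phi))) ->
  (forall v, entails G (Box (Iff (sub_formula v) (sub_formula (cl v))))) ->
  forall v, entails G (Iff (sub_formula v) (sub_formula (cl v))).
Proof.
move=> Gp Gbox v; have [u] : exists u, cl v = u by exists (cl v).
elim/unboxed_succ_ind: u v => u IH.
have nonvar v : lab v != LVar p -> cl v = u ->
    entails G (Iff (sub_formula v) (sub_formula (cl v))).
  move=> lv clv; have lcl : @lab X (cl v) = lab v.
    by rewrite -[RHS]/(lab v) -{2}(val_digamma_class lv).
  have scl : @succ X (cl v) = map cl (succ v).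
    by rewrite -{2}(val_digamma_class lv).
  apply: entails_iff_sub => // i iv; rewrite scl (nth_map v) //.
  (* Under a box [Gbox] applies; elsewhere the induction hypothesis does, since the classes of the
     successors are successors of [u]. *)
  case: ifP => [//|/negbT nb]; apply: IH erefl; first by rewrite -clv lcl.
  by rewrite -clv scl map_f // mem_nth.
move=> v clv; have [lv|] := eqVneq (lab v) (LVar p); last by move/nonvar; apply.
have clr : cl v = cl (root phi).
  by rewrite digamma_class_root digamma_class_var.
(* The leaf is bisimilar to [Var p], which [Gp] links to the root of [phi]; [nonvar] covers the
   root, as modalisation keeps [p] off its label. *)
rewrite clr; apply: entails_iff_trans (nonvar _ (modalised_root phi_mod) _).
  apply: entails_iff_trans Gp; apply/entails_const/CHL_bisim.
  apply: (bsim_trans (bsim_sym (bsim_sub v))); apply: bsim_step => //.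
  by rewrite size_succ lv.
by rewrite -clr.
Qed.
End VertexwiseEquivalence.

Theorem theorem3p8 (p : nat) (phi : formula) (phi_mod : modalised p phi)
  (q : nat) (q_fresh : ~~ occurs q (Iff (Var p) phi)) :
  CHL (Imp (BoxdotBullet q (Iff (Var p) phi))
           (Iff (Var p) (digamma phi_mod))).
Proof.
set B := BoxdotBullet _ _.
have subE (F : formula) : bisimilar F (sub_formula (root F)) := bsim_sub (root F).
have refl (F : formula) : bisimilar F F.
  exact: bsim_trans (subE F) (bsim_sym (subE F)).
have B_iff : entails B (Iff (Var p) (sub_formula (root phi))).
  apply: entails_iff_bisimilar (refl _) _ (entails_andl _ _).
  exact: bsim_sym (subE phi).
have B_box : entails B (Box B).
  apply: entails_trans (entails_andr _ _) _.
  (* The unfolded form of the second conjunct of [B] is [Box B] by definition. *)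
  exact: CHL_mp (entails_andl _ _) (CHL_bisim (BoxBullet_unfold q_fresh)).
pose cl := @digamma_class p phi : phi -> digamma phi_mod.
pose E v := Iff (sub_formula v) (sub_formula (cl v)).
pose D := Conj (fun v => Imp B (E v)) (enum phi).
have D_E v : entails D (Imp B (E v)).
  by apply: (conj_elim (fun v => Imp B (E v))); rewrite mem_enum.
have : CHL D.
  apply: CHL_lob; apply: conj_intro => v; apply: entails_imp.
  apply: entails_iff_sub_digamma => [|w].
    exact: entails_trans (entails_andr _ _) B_iff.
  (* From [Box D] comes [Box (Imp B (E w))], and K with [Box B] turns it into [Box (E w)]. *)
  apply: entails_mp (entails_trans (entails_andr _ _) B_box).
  apply: entails_trans (entails_andl _ _) _.
  exact: entails_trans (entails_Box (D_E w)) (CHL_K _ _).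
move=> cD; apply: entails_iff_trans B_iff _.
(* At the root, [cl] gives the root of [digamma phi_mod], whose subformula is the whole fixed point
   up to bisimilarity. *)
apply: entails_iff_bisimilar (refl _) _ (CHL_mp (D_E (root phi)) cD).
rewrite /cl digamma_class_root; exact: subE.
Qed.
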